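(* Let $(X,T)$ be a dynamical system that is distal but not equicontinuous. Then $SE_n^e(X,T)\neq\emptyset$ for every $n\ge 2$. Consequently $\sup_A h^A_{top}(T)=\infty$, the supremum over all increasing sequences $A\subseteq\mathbb{Z}_+$.
   Context: A dynamical system $(X,T)$ is a compact metric space $(X,d)$ with a continuous map $T:X\to X$. A pair $(x,y)$ is proximal if $\inf_{n\ge1}d(T^nx,T^ny)=0$; $(X,T)$ is distal if the only proximal pairs are $(x,x)$. $(X,T)$ is equicontinuous if $\{T^n:n\ge0\}$ is an equicontinuous family. For an increasing sequence $A=\{0\le t_1<t_2<\cdots\}\subseteq\mathbb{Z}_+$ and a finite open cover $\mathcal U$, $h^A_{top}(T,\mathcal U)=\limsup_{n\to\infty}\frac1n\log N(\bigvee_{i=1}^nT^{-t_i}\mathcal U)$, where $N(\cdot)$ is the minimal cardinality of a subcover, and $h^A_{top}(T)=\sup_{\mathcal U}h^A_{top}(T,\mathcal U)$. For $(x_i)_{i=1}^n\in X^n$, a finite cover $\mathcal U=\{U_1,\dots,U_k\}$ is admissible with respect to $(x_i)$ if for each $j$ there is $i_j$ with $x_{i_j}\notin\overline{U_j}$. An $n$-tuple $(x_i)_{i=1}^n$ ($n\ge2$) is a sequence entropy $n$-tuple if $x_i\ne x_j$ for some $i,j$ and for every admissible open cover $\mathcal U$ with respect to $(x_i)$ there is an increasing sequence $A$ with $h^A_{top}(T,\mathcal U)>0$. $SE_n^e(X,T)$ is the set of sequence entropy $n$-tuples with pairwise distinct coordinates. *)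

(* Defs.v *)
From Stdlib Require Import Reals List Arith ClassicalEpsilon.
Open Scope R_scope.

Section Dyn.
Context {X : Type} (d : X -> X -> R).

Definition is_metric : Prop :=
  (forall x y, 0 <= d x y) /\ (forall x y, d x y = 0 <-> x = y) /\
  (forall x y, d x y = d y x) /\ (forall x y z, d x z <= d x y + d y z).

Definition is_open (U : X -> Prop) : Prop :=
  forall x, U x -> exists r, 0 < r /\ forall y, d x y < r -> U y.

Definition closure (U : X -> Prop) (x : X) : Prop :=
  forall eps, 0 < eps -> exists y, U y /\ d x y < eps.

Definition compact_metric : Prop :=
  forall (I : Type) (V : I -> X -> Prop),
    (forall i, is_open (V i)) -> (forall x, exists i, V i x) ->
    exists l : list I, forall x, exists i, In i l /\ V i x.

Definition continuous_map (T : X -> X) : Prop :=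
  forall x eps, 0 < eps -> exists delta, 0 < delta /\
    forall y, d x y < delta -> d (T x) (T y) < eps.

Definition proximal (T : X -> X) (x y : X) : Prop :=
  forall eps, 0 < eps -> exists n, (1 <= n)%nat /\
    d (Nat.iter n T x) (Nat.iter n T y) < eps.

Definition distal (T : X -> X) : Prop :=
  forall x y, proximal T x y -> x = y.

Definition equicontinuous (T : X -> X) : Prop :=
  forall x eps, 0 < eps -> exists delta, 0 < delta /\
    forall y n, d x y < delta -> d (Nat.iter n T x) (Nat.iter n T y) < eps.

Definition finite_open_cover (U : list (X -> Prop)) : Prop :=
  Forall is_open U /\ forall x, exists V, In V U /\ V x.

Definition strictly_increasing (t : nat -> nat) : Prop :=
  forall i j, (i < j)%nat -> (t i < t j)%nat.

(* Elements of the join  \/_{i=1}^n T^{-t_i} U : indexed by choices f *)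
Definition join_elem (T : X -> X) (U : list (X -> Prop)) (t : nat -> nat)
  (n : nat) (f : nat -> nat) (x : X) : Prop :=
  forall i, (i < n)%nat -> nth (f i) U (fun _ => False) (Nat.iter (t i) T x).

Definition valid_choice (U : list (X -> Prop)) (n : nat) (f : nat -> nat) : Prop :=
  forall i, (i < n)%nat -> (f i < length U)%nat.

Definition join_subcover_card (T : X -> X) (U : list (X -> Prop)) (t : nat -> nat)
  (n m : nat) : Prop :=
  exists fs : list (nat -> nat), length fs = m /\ Forall (valid_choice U n) fs /\
    forall x, exists f, In f fs /\ join_elem T U t n f x.

Definition Njoin (T : X -> X) (U : list (X -> Prop)) (t : nat -> nat) (n : nat) : nat :=
  epsilon (inhabits 0%nat) (fun m => join_subcover_card T U t n m /\
     forall m', join_subcover_card T U t n m' -> (m <= m')%nat).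

Definition hseq (T : X -> X) (U : list (X -> Prop)) (t : nat -> nat) (n : nat) : R :=
  ln (INR (Njoin T U t n)) / INR n.

Definition admissible (U : list (X -> Prop)) (xs : list X) : Prop :=
  forall V, In V U -> exists x, In x xs /\ ~ closure V x.

End Dyn.

Definition is_limsup (u : nat -> R) (l : R) : Prop :=
  forall eps, 0 < eps ->
    (exists N, forall n, (N <= n)%nat -> u n < l + eps) /\
    (forall N, exists n, (N <= n)%nat /\ l - eps < u n).

(* h^A_top(T,U) = l, where A = {t 0 < t 1 < ...} *)
Definition htopA_cover {X : Type} (T : X -> X) (U : list (X -> Prop)) (t : nat -> nat)
  (l : R) : Prop := is_limsup (hseq T U t) l.

Definition seq_entropy_tuple {X : Type} (d : X -> X -> R) (T : X -> X) (xs : list X) : Prop :=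
  (exists x y, In x xs /\ In y xs /\ x <> y) /\
  forall U, finite_open_cover d U -> admissible d U xs ->
    exists t, strictly_increasing t /\ exists l, htopA_cover T U t l /\ 0 < l.

Definition in_SEe {X : Type} (d : X -> X -> R) (T : X -> X) (n : nat) (xs : list X) : Prop :=
  length xs = n /\ NoDup xs /\ seq_entropy_tuple d T xs.

(* Main.v *)
Require Import Defs.
From Stdlib Require Import Reals List Arith Lra Lia Classical ClassicalEpsilon.
From mathcomp Require classical_sets.
Open Scope R_scope.

(** Let x_k -> x witness the failure of equicontinuity. For small eta stop the pair (x, x_k) just
    before its distance exceeds eta, and pull the limit of the stopped pairs back by the inverse
    in the Ellis group, which is a group by distality. This gives a point x' <> x, with
    inf_n d(T^n x, T^n x') at most of order eta, which is approached by points T^t x_k along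
    times t at which any prescribed finite set of points nearly returns to itself. By distality
    a smaller eta yields a different x', so that one sequence x_k reaches any number n of
    distinct points x' in this way. Adding such return times realises successively all words
    over these n points as itineraries along a common finite set of times; concatenating longer
    and longer finite sets gives sequences along which the joins need exponentially many elements. *)

(** * Idempotent ultrafilters *)

Definition family := (nat -> Prop) -> Prop.

Definition incl_family (F G : family) : Prop := forall A, F A -> G A.

Record is_filter (F : family) : Prop := {
  filter_full : F (fun _ => True);
  filter_up : forall A B, F A -> (forall n, A n -> B n) -> F B;
  filter_and : forall A B, F A -> F B -> F (fun n => A n /\ B n);
  filter_proper : ~ F (fun _ => False) }.

Definition ultrafilter (F : family) : Prop :=
  is_filter F /\ forall A, F A \/ F (fun n => ~ A n).

Definition shift (A : nat -> Prop) (n m : nat) : Prop := A (n + m)%nat.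

(* The product of families: for ultrafilters this is addition in the Stone-Cech compactification of nat. *)
Definition fprod (F G : family) : family := fun A => F (fun n => G (shift A n)).

Definition is_union (C : family -> Prop) (U : family) : Prop :=
  forall A, U A <-> exists F, C F /\ F A.

(** [Zorn_bigcup] asks for the union of every chain, even the empty one, and gives no lower bound.
    So [P] admits the empty family and otherwise only families above [F0]; as [F0] is nonempty, the
    maximal family is not the empty one. *)
Lemma zorn_families (Q : family -> Prop) (F0 : family) :
  Q F0 -> (exists A, F0 A) ->
  (forall C U, is_union C U -> (exists F, C F) -> (forall F, C F -> Q F) ->
     (forall F G, C F -> C G -> incl_family F G \/ incl_family G F) -> Q U) ->
  exists F, incl_family F0 F /\ Q F /\ forall G, Q G -> incl_family F G -> incl_family G F.
Proof.
  intros HF0 [A0 HA0] Hchain.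
  pose (P := fun S : family => (forall A, ~ S A) \/ (Q S /\ incl_family F0 S)).
  destruct (@classical_sets.Zorn_bigcup (nat -> Prop) P) as [F [HPF Hmax]].
  - intros C HC Htot.
    destruct (classic (exists S, C S /\ Q S /\ incl_family F0 S)) as [[S [HS [HQS HiS]]]|Hno].
    + right. split.
      * apply (Hchain (fun S => C S /\ Q S /\ incl_family F0 S)).
        -- intros A. split.
           ++ intros [G HG HGA]. exists G. destruct (HC G HG) as [He|Hg].
              ** exfalso. exact (He A HGA).
              ** split; [split|]; assumption.
           ++ intros [G [[HG _] HGA]]. exists G; assumption.
        -- exists S. auto.
        -- intros G [_ [HG _]]. exact HG.
        -- intros G H [HG _] [HH _]. exact (Htot G H HG HH).
      * intros A HA. exists S; auto.
    + left. intros A [G HG HGA]. destruct (HC G HG) as [He|Hg].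
      * exact (He A HGA).
      * apply Hno. exists G. tauto.
  - assert (Hup : forall G, P G -> incl_family F G -> incl_family G F).
    { intros G HPG HFG. apply NNPP. intros Hn. apply (Hmax G); [|exact HPG].
      split; [exact HFG|exact Hn]. }
    destruct HPF as [He|[HQ Hi]].
    + exfalso. apply (He A0). apply (Hup F0); [right; split; [exact HF0|intros A; auto]| |exact HA0].
      intros A HA. destruct (He A HA).
    + exists F. split; [exact Hi|split; [exact HQ|]].
      intros G HG HFG. apply Hup; [right; split; [exact HG|]|exact HFG].
      intros A HA. apply HFG, Hi, HA.
Qed.

Lemma filter_chain_union C U :
  is_union C U -> (exists F, C F) -> (forall F, C F -> is_filter F) ->
  (forall F G, C F -> C G -> incl_family F G \/ incl_family G F) -> is_filter U.
Proof.
  intros HU [F0 HF0] HC Htot. split.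
  - apply HU. exists F0. split; [exact HF0|apply HC, HF0].
  - intros A B HA HAB. apply HU in HA. destruct HA as [F [HF HA]]. apply HU.
    exists F. split; [exact HF|]. apply (filter_up F (HC F HF) A); assumption.
  - intros A B HA HB. apply HU in HA. apply HU in HB.
    destruct HA as [F [HF HA]], HB as [G [HG HB]]. apply HU.
    destruct (Htot F G HF HG) as [H|H].
    + exists G. split; [exact HG|]. apply (filter_and G (HC G HG)); [apply H, HA|exact HB].
    + exists F. split; [exact HF|]. apply (filter_and F (HC F HF)); [exact HA|apply H, HB].
  - intros H. apply HU in H. destruct H as [F [HF H]]. exact (filter_proper F (HC F HF) H).
Qed.

Lemma filter_ex F A : is_filter F -> F A -> exists n, A n.
Proof.
  intros HF HA. apply NNPP. intros Hn. apply (filter_proper F HF).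
  apply (filter_up F HF A); [exact HA|]. intros n Hn'. apply Hn. exists n; exact Hn'.
Qed.

Lemma ultrafilter_extends F0 : is_filter F0 -> exists F, incl_family F0 F /\ ultrafilter F.
Proof.
  intros HF0.
  destruct (zorn_families is_filter F0 HF0) as [F [Hi [HF Hmax]]].
  - exists (fun _ => True). apply filter_full, HF0.
  - exact filter_chain_union.
  - exists F. split; [exact Hi|split; [exact HF|]]. intros A.
    destruct (classic (F (fun n => ~ A n))) as [H|H]; [right; exact H|left].
    (* The filter generated by [F] and [A] is proper, since the complement of [A] is not in [F]; by
       maximality it is [F]. *)
    apply (Hmax (fun B => exists D, F D /\ forall n, D n /\ A n -> B n)).
    + split.
      * exists (fun _ => True). split; [apply filter_full, HF|auto].
      * intros B B' [D [HD HB]] HBB'. exists D. auto.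
      * intros B B' [D [HD HB]] [D' [HD' HB']]. exists (fun n => D n /\ D' n).
        split; [apply (filter_and F HF); assumption|]. intros n [[H1 H2] H3]. auto.
      * intros [D [HD HB]]. apply H. apply (filter_up F HF D); [exact HD|].
        intros n HDn HAn. exact (HB n (conj HDn HAn)).
    + intros B HB. exists B. split; [exact HB|]. tauto.
    + exists (fun _ => True). split; [apply filter_full, HF|]. tauto.
Qed.

Lemma ultrafilter_not F A : ultrafilter F -> ~ F A -> F (fun n => ~ A n).
Proof. intros [_ H] HA. destruct (H A); tauto. Qed.

Lemma ultrafilter_contra F A : ultrafilter F -> F A -> ~ F (fun n => ~ A n).
Proof.
  intros [HF _] HA HnA. apply (filter_proper F HF).
  apply (filter_up F HF _ _ (filter_and F HF _ _ HA HnA)). tauto.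
Qed.

Lemma fprod_filter F G : is_filter F -> is_filter G -> is_filter (fprod F G).
Proof.
  intros HF HG. split; unfold fprod, shift.
  - apply (filter_up F HF (fun _ => True)); [apply filter_full, HF|].
    intros n _. apply filter_full, HG.
  - intros A B HA HAB. apply (filter_up F HF _ _ HA). intros n Hn.
    apply (filter_up G HG _ _ Hn). intros m; apply HAB.
  - intros A B HA HB. apply (filter_up F HF _ _ (filter_and F HF _ _ HA HB)).
    intros n [H1 H2]. exact (filter_and G HG _ _ H1 H2).
  - intros H. apply (filter_ex F _ HF) in H. destruct H as [n H].
    exact (filter_proper G HG H).
Qed.

(* Papazyan's filter form of the Ellis-Numakura lemma: an additive filter
   corresponds to a closed subsemigroup of the Stone-Cech compactification. *)
Lemma idempotent_ultrafilter F0 :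
  is_filter F0 -> incl_family F0 (fprod F0 F0) ->
  exists p, incl_family F0 p /\ ultrafilter p /\ incl_family p (fprod p p).
Proof.
  intros HF0 Hadd0.
  destruct (zorn_families (fun F => is_filter F /\ incl_family F (fprod F F)) F0) as
    [F [Hi [[HF Hadd] Hmax]]].
  - auto.
  - exists (fun _ => True). apply filter_full, HF0.
  - intros C U HU Hne HC Htot. split.
    + apply (filter_chain_union C); auto. intros F HF; apply HC, HF.
    + intros A HA. apply HU in HA. destruct HA as [F [HF HA]].
      destruct (HC F HF) as [HFf HFa]. apply HU. exists F. split; [exact HF|].
      apply (filter_up F HFf _ _ (HFa A HA)). intros n Hn. apply HU. exists F. auto.
  - destruct (ultrafilter_extends F HF) as [p [Hip Hp]].
    assert (Hpf := proj1 Hp).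
    (* If S is the minimal closed subsemigroup given by [F] and p lies in S, then S + p is a closed
       subsemigroup of S, hence S + p = S. *)
    assert (HFp : incl_family (fprod F p) F).
    { apply Hmax.
      - split; [apply fprod_filter; assumption|].
        intros A HA.
        assert (HC := Hadd _ HA).
        assert (HC' : F (fun n => fprod F p (shift A n))).
        { apply (filter_up F HF _ _ HC). intros n Hn. unfold fprod.
          apply (filter_up F HF _ _ Hn). intros m Hm. unfold shift in *.
          apply (filter_up p Hpf _ _ Hm). intros k Hk. rewrite Nat.add_assoc. exact Hk. }
        apply Hadd in HC'. apply (filter_up F HF _ _ HC'). intros n Hn.
        apply Hip, Hn.
      - intros A HA. apply Hadd in HA. apply (filter_up F HF _ _ HA).
        intros n Hn. apply Hip, Hn. }
    (* The q in S with q + p = p form a closed subsemigroup, nonempty because S + p = S. By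
       minimality it is all of S, so it contains p. *)
    assert (Hfix : forall A, p A -> F (fun n => p (shift A n))).
    { intros A HA.
      assert (Hinc : incl_family
        (fun B => exists D E, F D /\ p E /\ forall n, D n /\ p (shift E n) -> B n) F).
      { apply Hmax.
        - split.
          + split.
            * exists (fun _ => True), (fun _ => True). repeat split; [apply filter_full, HF|apply filter_full, Hpf].
            * intros B B' [D [E [HD [HE HB]]]] HBB'. exists D, E. auto.
            * intros B B' [D [E [HD [HE HB]]]] [D' [E' [HD' [HE' HB']]]].
              exists (fun n => D n /\ D' n), (fun n => E n /\ E' n).
              split; [apply (filter_and F HF); assumption|].
              split; [apply (filter_and p Hpf); assumption|].
              intros n [[H1 H2] H3]. split.
              -- apply HB. split; [exact H1|]. apply (filter_up p Hpf _ _ H3). unfold shift; tauto.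
              -- apply HB'. split; [exact H2|]. apply (filter_up p Hpf _ _ H3). unfold shift; tauto.
            * intros [D [E [HD [HE HB]]]].
              apply (ultrafilter_contra p E Hp HE).
              apply Hip, HFp. apply (filter_up F HF D); [exact HD|].
              intros n HDn. apply (ultrafilter_not p (shift E n) Hp). intros H. exact (HB n (conj HDn H)).
          + intros B [D [E [HD [HE HB]]]].
            exists (fun n => F (shift D n)), E. split; [apply Hadd, HD|]. split; [exact HE|].
            intros n [HDn HEn]. exists (shift D n), (shift E n).
            split; [exact HDn|]. split; [exact HEn|]. intros m [H1 H2]. apply HB.
            split; [exact H1|]. apply (filter_up p Hpf _ _ H2). intros k Hk.
            unfold shift in *. rewrite <- Nat.add_assoc. exact Hk.
        - intros B HB. exists B, (fun _ => True). split; [exact HB|].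
          split; [apply filter_full, Hpf|tauto]. }
      apply Hinc. exists (fun _ => True), A. split; [apply filter_full, HF|]. tauto. }
    exists p. split; [intros A HA; apply Hip, Hi, HA|]. split; [exact Hp|].
    intros A HA. apply Hip, Hfix, HA.
Qed.

(** * Words, covers and upper limits *)

Fixpoint list_choices {A : Type} (ls : list (list A)) : list (list A) :=
  match ls with
  | nil => nil :: nil
  | l :: ls => flat_map (fun a => map (cons a) (list_choices ls)) l
  end.

Definition words {A : Type} (l : list A) (m : nat) : list (list A) := list_choices (repeat l m).

Lemma in_list_choices {A : Type} (a0 : A) ls w :
  In w (list_choices ls) <->
  length w = length ls /\ forall i, (i < length ls)%nat -> In (nth i w a0) (nth i ls nil).
Proof.
  revert w. induction ls as [|l ls IH]; intros w; simpl.
  - split.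
    + intros [<-|[]]. split; [reflexivity|]. intros i Hi; lia.
    + intros [Hw _]. left. destruct w; [reflexivity|discriminate].
  - rewrite in_flat_map. split.
    + intros [a [Ha Hw]]. apply in_map_iff in Hw. destruct Hw as [v [<- Hv]].
      apply IH in Hv. destruct Hv as [Hl Hv]. split; [simpl; congruence|].
      intros [|i] Hi; [exact Ha|]. apply Hv. lia.
    + intros [Hl Hw]. destruct w as [|a v]; [discriminate|]. exists a.
      split; [exact (Hw 0%nat ltac:(lia))|]. apply in_map. apply IH.
      split; [simpl in Hl; lia|]. intros i Hi. apply (Hw (S i)). lia.
Qed.

Lemma nth_repeat_lt {A : Type} (a b : A) m i : (i < m)%nat -> nth i (repeat a m) b = a.
Proof. revert i. induction m as [|m IH]; intros [|i] Hi; simpl; try lia; auto. apply IH. lia. Qed.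

Lemma in_words {A : Type} (a0 : A) l m w :
  In w (words l m) <-> length w = m /\ forall i, (i < m)%nat -> In (nth i w a0) l.
Proof.
  unfold words. rewrite (in_list_choices a0), repeat_length. split; intros [H1 H2]; (split; [exact H1|]);
    intros i Hi; specialize (H2 i Hi); rewrite nth_repeat_lt in *; auto.
Qed.

Lemma flat_map_cons_length {A : Type} (l : list A) (v : list (list A)) :
  length (flat_map (fun a => map (cons a) v) l) = (length l * length v)%nat.
Proof. induction l as [|a l IH]; simpl; [reflexivity|]. rewrite length_app, length_map, IH. lia. Qed.

Lemma words_length {A : Type} (l : list A) m : length (words l m) = (length l ^ m)%nat.
Proof.
  unfold words. induction m as [|m IH]; simpl; [reflexivity|].
  rewrite flat_map_cons_length, IH. reflexivity.
Qed.

Lemma list_choices_length_le {A : Type} (ls : list (list A)) c :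
  (forall l, In l ls -> (length l <= c)%nat) -> (length (list_choices ls) <= c ^ length ls)%nat.
Proof.
  induction ls as [|l ls IH]; intros H; simpl; [lia|]. rewrite flat_map_cons_length.
  apply Nat.mul_le_mono; [apply H; left; reflexivity|]. apply IH. intros l' Hl'. apply H. right; exact Hl'.
Qed.

Lemma words_NoDup {A : Type} (l : list A) m : NoDup l -> NoDup (words l m).
Proof.
  intros Hl. unfold words. induction m as [|m IH]; simpl.
  - constructor; [intros []|constructor].
  - remember (list_choices (repeat l m)) as v eqn:Hv. clear Hv.
    assert (H : forall l', NoDup l' -> NoDup (flat_map (fun a => map (cons a) v) l')).
    { induction l' as [|a l' IH']; intros Hnd; simpl; [constructor|].
      inversion Hnd as [|? ? Ha Hnd']; subst. apply NoDup_app.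
      - apply NoDup_map_inv with (f := @tl A). rewrite map_map. simpl. rewrite map_id. exact IH.
      - apply IH', Hnd'.
      - intros w Hw Hw'. apply in_map_iff in Hw. destruct Hw as [w1 [<- _]].
        apply in_flat_map in Hw'. destruct Hw' as [b [Hb Hw']].
        apply in_map_iff in Hw'. destruct Hw' as [w2 [E _]]. inversion E; subst. contradiction. }
    apply H, Hl.
Qed.

Lemma length_flat_map_le {A B : Type} (f : A -> list B) l k :
  (forall a, In a l -> (length (f a) <= k)%nat) -> (length (flat_map f l) <= length l * k)%nat.
Proof.
  induction l as [|a l IH]; intros H; simpl; [lia|]. rewrite length_app.
  pose proof (H a (or_introl eq_refl)). pose proof (IH (fun b Hb => H b (or_intror Hb))). lia.
Qed.

Lemma strictly_increasing_succ t : (forall i, (t i < t (S i))%nat) -> strictly_increasing t.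
Proof. intros H i j Hij. induction Hij as [|j Hij IH]; [apply H|]. specialize (H j). lia. Qed.

(** The upper limit is the supremum of the levels that [u] reaches at arbitrarily large indices. The
    bound starts at n = 1 because [hseq] divides by n. *)
Lemma limsup_exists (u : nat -> R) B v :
  (forall n, (1 <= n)%nat -> u n <= B) -> (forall N, exists n, (N <= n)%nat /\ v <= u n) ->
  exists l, is_limsup u l /\ v <= l.
Proof.
  intros HB Hv. pose (E := fun a => forall N, exists n, (N <= n)%nat /\ a <= u n).
  destruct (completeness E) as [l [Hub Hlub]].
  - exists B. intros a Ha. destruct (Ha 1%nat) as [n [Hn Hu]]. specialize (HB n Hn). lra.
  - exists v. exact Hv.
  - exists l. split; [|apply Hub; exact Hv]. intros eps Heps. split.
    + apply NNPP. intros Hno. assert (He : E (l + eps)).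
      { intros N. apply NNPP. intros HN. apply Hno. exists N. intros n Hn. apply Rnot_le_lt.
        intros Hle. apply HN. exists n. auto. }
      apply Hub in He. lra.
    + intros N. apply NNPP. intros HN. assert (l <= l - eps); [|lra].
      apply Hlub. intros a Ha. apply Rnot_lt_le. intros Hlt. apply HN.
      destruct (Ha N) as [n [Hn Hu]]. exists n. split; [exact Hn|lra].
Qed.

Definition subcover_number {X : Type} (T : X -> X) U t n m : Prop :=
  join_subcover_card T U t n m /\ forall m', join_subcover_card T U t n m' -> (m <= m')%nat.

(** All |U|^n elements of the join together form a subcover. Hence a least cardinality exists, and
    [hseq] is bounded by ln |U|. *)
Lemma join_subcover_all {X : Type} (T : X -> X) (U : list (X -> Prop)) t n :
  (forall x, exists V, In V U /\ V x) -> join_subcover_card T U t n (length U ^ n).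
Proof.
  intros Hcov. exists (map (fun w i => nth i w 0%nat) (words (seq 0 (length U)) n)).
  split; [rewrite length_map, words_length, length_seq; reflexivity|]. split.
  - apply Forall_forall. intros f Hf. apply in_map_iff in Hf. destruct Hf as [w [<- Hw]].
    apply (in_words 0%nat) in Hw. intros i Hi. apply (proj2 Hw) in Hi. apply in_seq in Hi. lia.
  - intros x. destruct (choice (fun i k => (k < length U)%nat /\
      nth k U (fun _ => False) (Nat.iter (t i) T x))) as [f Hf].
    { intros i. destruct (Hcov (Nat.iter (t i) T x)) as [V [HV Hx]].
      destruct (In_nth U V (fun _ => False) HV) as [k [Hk E]]. exists k. rewrite E. auto. }
    (* The list holds only words of length n, extended by 0, so [f] is cut off after its first n
       values. *)
    assert (Hnth : forall i, (i < n)%nat -> nth i (map f (seq 0 n)) 0%nat = f i).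
    { intros i Hi. rewrite nth_indep with (d' := f 0%nat); [|rewrite length_map, length_seq; exact Hi].
      rewrite map_nth, seq_nth; auto. }
    exists (fun i => nth i (map f (seq 0 n)) 0%nat). split.
    + apply in_map_iff. exists (map f (seq 0 n)). split; [reflexivity|].
      apply (in_words 0%nat). split; [rewrite length_map, length_seq; reflexivity|].
      intros i Hi. rewrite Hnth by exact Hi. apply in_seq. destruct (Hf i). lia.
    + intros i Hi. rewrite Hnth by exact Hi. apply Hf.
Qed.

Lemma Njoin_spec {X : Type} (T : X -> X) (U : list (X -> Prop)) t n :
  (forall x, exists V, In V U /\ V x) -> subcover_number T U t n (Njoin T U t n).
Proof.
  intros Hcov. unfold Njoin. apply epsilon_spec.
  destruct (dec_inh_nat_subset_has_unique_least_element (join_subcover_card T U t n)) as [m [Hm _]].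
  - intros m. apply classic.
  - eexists. apply join_subcover_all, Hcov.
  - exists m. exact Hm.
Qed.

Lemma Njoin_pos {X : Type} (T : X -> X) (U : list (X -> Prop)) t n (x0 : X) :
  (forall x, exists V, In V U /\ V x) -> (1 <= Njoin T U t n)%nat.
Proof.
  intros Hcov. destruct (Njoin_spec T U t n Hcov) as [[fs [Hl [_ Hx]]] _].
  destruct (Hx x0) as [f [Hf _]]. destruct fs; [destruct Hf|simpl in Hl; lia].
Qed.

Lemma hseq_le {X : Type} (T : X -> X) (U : list (X -> Prop)) t n (x0 : X) :
  (forall x, exists V, In V U /\ V x) -> (1 <= n)%nat -> hseq T U t n <= ln (INR (length U)).
Proof.
  intros Hcov Hn. destruct (Njoin_spec T U t n Hcov) as [_ Hmin].
  specialize (Hmin _ (join_subcover_all T U t n Hcov)).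
  pose proof (Njoin_pos T U t n x0 Hcov) as Hpos.
  assert (HU : (0 < length U)%nat).
  { destruct (Hcov x0) as [V [HV _]]. destruct U; [destruct HV|simpl; lia]. }
  assert (Hn' : 0 < INR n) by (apply lt_0_INR; lia).
  unfold hseq. apply Rmult_le_reg_r with (INR n); [exact Hn'|].
  unfold Rdiv. rewrite Rmult_assoc, Rinv_l, Rmult_1_r by lra.
  rewrite Rmult_comm, <- ln_pow, <- pow_INR by (apply lt_0_INR; exact HU).
  apply le_INR in Hmin. destruct Hmin as [Hlt|E].
  - left. apply ln_increasing; [apply lt_0_INR; lia|exact Hlt].
  - right. rewrite E. reflexivity.
Qed.

(** Stands for the minimum of finitely many positive radii, for a property inherited by smaller
    ones. *)
Lemma finite_radius {A : Type} (l : list A) (Q : A -> R -> Prop) :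
  (forall a r r', Q a r -> r' <= r -> Q a r') ->
  (forall a, In a l -> exists r, 0 < r /\ Q a r) ->
  exists r, 0 < r /\ forall a, In a l -> Q a r.
Proof.
  intros Hmono. induction l as [|a l IH]; intros H.
  - exists 1. split; [lra|]. intros a [].
  - destruct IH as [r [Hr Hl]]; [intros b Hb; apply H; right; exact Hb|].
    destruct (H a (or_introl eq_refl)) as [r' [Hr' Ha]].
    exists (Rmin r r'). split; [apply Rmin_glb_lt; assumption|].
    intros b [<-|Hb].
    + apply (Hmono _ r'); [exact Ha|apply Rmin_r].
    + apply (Hmono _ r); [apply Hl, Hb|apply Rmin_l].
Qed.

Lemma filter_forall_in {A : Type} F (l : list A) (Q : A -> nat -> Prop) :
  is_filter F -> (forall a, In a l -> F (Q a)) -> F (fun n => forall a, In a l -> Q a n).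
Proof.
  intros HF. induction l as [|a l IH]; intros H.
  - apply (filter_up F HF (fun _ => True)); [apply filter_full, HF|]. intros n _ a [].
  - apply (filter_up F HF _ _ (filter_and F HF _ _ (H a (or_introl eq_refl))
      (IH (fun b Hb => H b (or_intror Hb))))).
    intros n [H1 H2] b [<-|Hb]; auto.
Qed.

(** * Distal systems *)

Section CompactMetric.
Context {X : Type} (d : X -> X -> R) (Hmet : is_metric d) (Hcpt : compact_metric d).

Lemma dist_nonneg x y : 0 <= d x y.
Proof. apply Hmet. Qed.

Lemma dist_refl x : d x x = 0.
Proof. apply Hmet. reflexivity. Qed.

Lemma dist_sym x y : d x y = d y x.
Proof. apply Hmet. Qed.

Lemma dist_triangle x y z : d x z <= d x y + d y z.
Proof. apply Hmet. Qed.

Lemma dist_pos x y : x <> y -> 0 < d x y.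
Proof.
  intros H. destruct (Rle_lt_or_eq_dec 0 (d x y) (dist_nonneg x y)) as [H1|H1]; [exact H1|].
  exfalso. apply H, Hmet. symmetry; exact H1.
Qed.

Lemma dist_eq x y : (forall eps, 0 < eps -> d x y < eps) -> x = y.
Proof.
  intros H. apply NNPP. intros Hn. pose proof (H _ (dist_pos x y Hn)). lra.
Qed.

Lemma ball_open x r : is_open d (fun y => d x y < r).
Proof.
  intros y Hy. exists (r - d x y). split; [lra|]. intros z Hz.
  pose proof (dist_triangle x y z). lra.
Qed.

(** The cover is indexed by all triples of a centre, a datum and a radius that satisfy [Q], so each
    ball of the finite subcover carries its own datum. *)
Lemma compact_balls (B : Type) (Q : X -> B -> R -> Prop) :
  (forall x, exists b r, 0 < r /\ Q x b r) ->
  exists l : list (X * B * R),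
    (forall x b r, In (x, b, r) l -> 0 < r /\ Q x b r) /\
    forall y, exists x b r, In (x, b, r) l /\ d x y < r.
Proof.
  intros H.
  destruct (Hcpt {i : X * B * R | 0 < snd i /\ Q (fst (fst i)) (snd (fst i)) (snd i)}
    (fun i y => d (fst (fst (proj1_sig i))) y < snd (proj1_sig i))) as [l Hl].
  - intros i. apply ball_open.
  - intros x. destruct (H x) as [b [r [Hr HQ]]].
    exists (exist _ (x, b, r) (conj Hr HQ)). simpl. rewrite dist_refl. exact Hr.
  - exists (map (@proj1_sig _ _) l). split.
    + intros x b r Hin. apply in_map_iff in Hin. destruct Hin as [[i Hi] [He _]].
      simpl in He. subst i. exact Hi.
    + intros y. destruct (Hl y) as [[[[x b] r] Hi] [Hin Hy]]. exists x, b, r.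
      split; [|exact Hy]. apply in_map_iff. eexists. split; [|exact Hin]. reflexivity.
Qed.

(** Otherwise every point has a ball that [a k] avoids for [F]-almost all k; finitely many such
    balls cover the space, and some [a k] would avoid them all. *)
Lemma ultrafilter_limit F (a : nat -> X) :
  ultrafilter F -> exists L, forall eps, 0 < eps -> F (fun k => d (a k) L < eps).
Proof.
  intros HF. apply NNPP. intros Hn.
  destruct (compact_balls unit (fun x _ r => F (fun k => ~ d x (a k) < r))) as [l [Hl Hc]].
  - intros x. exists tt. apply NNPP. intros Hx. apply Hn. exists x. intros eps Heps.
    apply NNPP. intros HnF. apply Hx. exists eps. split; [exact Heps|].
    apply (filter_up F (proj1 HF) _ _ (ultrafilter_not F _ HF HnF)).
    intros k Hk. rewrite dist_sym. exact Hk.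
  - destruct (filter_ex F _ (proj1 HF) (filter_forall_in F l
      (fun i k => ~ d (fst (fst i)) (a k) < snd i) (proj1 HF)
      ltac:(intros [[x b] r] Hi; apply Hl in Hi; apply Hi))) as [k Hk].
    destruct (Hc (a k)) as [x [b [r [Hi Hlt]]]]. exact (Hk _ Hi Hlt).
Qed.

(** Compactness for a net directed by growing [l] and shrinking [r]. A finite list of points with a
    radius is a basic neighbourhood for pointwise convergence of maps, so this yields limits along
    elements of the Ellis group. *)
Lemma cluster_point (C : list X -> R -> X -> Prop) :
  (forall l l' r r' c, incl l l' -> r' <= r -> C l' r' c -> C l r c) ->
  (forall l r, 0 < r -> exists c, C l r c) ->
  exists x, forall l r, 0 < r -> exists c, C l r c /\ d c x < r.
Proof.
  intros Hmono Hne. apply NNPP. intros Hn.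
  destruct (compact_balls (list X)
    (fun x l r => forall c, C l r c -> ~ d c x < r)) as [L [HL Hc]].
  - intros x. apply NNPP. intros Hx. apply Hn. exists x. intros l r Hr.
    apply NNPP. intros Hlr. apply Hx. exists l, r. split; [exact Hr|].
    intros c HC Hd. apply Hlr. exists c; auto.
  - destruct (finite_radius L (fun i r => r <= snd i)) as [r [Hr Hrl]].
    + intros i r r' H1 H2. lra.
    + intros [[x l] r] Hi. exists r. split; [apply (HL _ _ _ Hi)|simpl; lra].
    + destruct (Hne (flat_map (fun i => snd (fst i)) L) r Hr) as [c HC].
      destruct (Hc c) as [x [l [r' [Hi Hd]]]].
      apply (proj2 (HL _ _ _ Hi) c).
      * apply (Hmono l (flat_map (fun i => snd (fst i)) L) r' r); [|exact (Hrl _ Hi)|exact HC].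
        intros z Hz. apply in_flat_map. exists (x, l, r'). auto.
      * rewrite dist_sym. exact Hd.
Qed.

Context (T : X -> X) (Hcont : continuous_map d T).

Lemma uniformly_continuous eps :
  0 < eps -> exists delta, 0 < delta /\ forall x y, d x y < delta -> d (T x) (T y) < eps.
Proof.
  intros Heps.
  destruct (compact_balls unit (fun x _ r => forall y, d x y < 2 * r -> d (T x) (T y) < eps / 2))
    as [L [HL Hc]].
  - intros x. destruct (Hcont x (eps / 2)) as [r [Hr H]]; [lra|].
    exists tt, (r / 2). split; [lra|]. intros y Hy. apply H. lra.
  - destruct (finite_radius L (fun i r => r <= snd i)) as [r [Hr Hrl]].
    + intros i r r' H1 H2. lra.
    + intros [[x l] r] Hi. exists r. split; [apply (HL _ _ _ Hi)|simpl; lra].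
    + exists r. split; [exact Hr|]. intros y z Hyz.
      destruct (Hc y) as [x [u [r' [Hi Hd]]]].
      destruct (HL _ _ _ Hi) as [Hr' HQ]. pose proof (Hrl _ Hi) as Hrr. simpl in Hrr.
      pose proof (HQ y ltac:(lra)). pose proof (dist_triangle x y z).
      pose proof (HQ z ltac:(lra)). pose proof (dist_triangle (T y) (T x) (T z)).
      rewrite (dist_sym (T y) (T x)) in *. lra.
Qed.

Lemma iter_uniformly_continuous n eps :
  0 < eps -> exists delta, 0 < delta /\
    forall x y, d x y < delta -> d (Nat.iter n T x) (Nat.iter n T y) < eps.
Proof.
  revert eps. induction n as [|n IH]; intros eps Heps.
  - exists eps. auto.
  - destruct (uniformly_continuous eps Heps) as [e [He H]].
    destruct (IH e He) as [delta [Hd H']]. exists delta. split; [exact Hd|].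
    intros x y Hxy. simpl. apply H, H', Hxy.
Qed.

Lemma iter_limit F (a : nat -> X) L n : is_filter F ->
  (forall eps, 0 < eps -> F (fun k => d (a k) L < eps)) ->
  forall eps, 0 < eps -> F (fun k => d (Nat.iter n T (a k)) (Nat.iter n T L) < eps).
Proof.
  intros HF Ha eps Heps. destruct (iter_uniformly_continuous n eps Heps) as [e [He H]].
  apply (filter_up F HF _ _ (Ha e He)). intros k Hk. apply H, Hk.
Qed.

Context (Hdist : distal d T).

(** Write p a for the limit of T^n a along p. Then p b = p p a = p a = b, so a and b are proximal.
    Times at least 1 are required because only these count for proximality. *)
Lemma idempotent_limit p (a b : X) :
  ultrafilter p -> incl_family p (fprod p p) -> p (fun n => (1 <= n)%nat) ->
  (forall eps, 0 < eps -> p (fun n => d (Nat.iter n T a) b < eps)) -> a = b.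
Proof.
  intros Hp Hadd H1 Hlim. apply Hdist. intros eps Heps. assert (Hf := proj1 Hp).
  assert (HA := Hlim (eps / 3) ltac:(lra)).
  destruct (filter_ex p _ Hf (filter_and p Hf _ _ H1 (filter_and p Hf _ _ HA (Hadd _ HA))))
    as [n [Hn [Han Hshift]]].
  exists n. split; [exact Hn|].
  destruct (filter_ex p _ Hf (filter_and p Hf _ _ Hshift
    (iter_limit p (fun m => Nat.iter m T a) b n Hf Hlim (eps / 3) ltac:(lra)))) as [m [Hm1 Hm2]].
  unfold shift in Hm1. rewrite Nat.iter_add in Hm1.
  pose proof (dist_triangle (Nat.iter n T a) b (Nat.iter n T b)).
  pose proof (dist_triangle b (Nat.iter n T (Nat.iter m T a)) (Nat.iter n T b)).
  rewrite (dist_sym b (Nat.iter n T (Nat.iter m T a))) in *. lra.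
Qed.

(* Orbit closures in the powers of a distal system are minimal. *)
Lemma orbit_closure_symmetric (l : list (X * X)) :
  (forall delta, 0 < delta -> exists t, forall f g, In (f, g) l -> d (Nat.iter t T f) g < delta) ->
  forall delta, 0 < delta -> exists s, forall f g, In (f, g) l -> d (Nat.iter s T g) f < delta.
Proof.
  intros Hl.
  (* Let f and g be the tuples of first and second components. The sets [A delta] generate the
     filter of all q for which q f lies in the orbit closure of g. These q form a closed
     subsemigroup, as that closure is invariant. An idempotent among them fixes f by distality, so f
     itself lies in the orbit closure of g. *)
  pose (A := fun delta t => (1 <= t)%nat /\ exists s, forall f g, In (f, g) l ->
    d (Nat.iter t T f) (Nat.iter s T g) < delta).
  pose (F0 := fun B : nat -> Prop => exists delta, 0 < delta /\ forall t, A delta t -> B t).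
  assert (HF0 : is_filter F0).
  { split.
    - exists 1. split; [lra|auto].
    - intros B B' [e [He H]] HBB. exists e. auto.
    - intros B B' [e [He H]] [e' [He' H']]. exists (Rmin e e').
      split; [apply Rmin_glb_lt; assumption|].
      intros t [Ht [s Hs]]. pose proof (Rmin_l e e'). pose proof (Rmin_r e e').
      split; [apply H|apply H']; (split; [exact Ht|]); exists s; intros f g Hfg;
        specialize (Hs f g Hfg); lra.
    - intros [e [He H]]. destruct (iter_uniformly_continuous 1 e He) as [e' [He' H']].
      destruct (Hl e' He') as [t Ht]. apply (H (S t)). split; [lia|].
      exists 1%nat. intros f g Hfg. apply H', Ht, Hfg. }
  destruct (idempotent_ultrafilter F0 HF0) as [p [Hi [Hp Hadd]]].
  { intros B [e [He H]]. exists 1. split; [lra|]. intros n _.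
    destruct (iter_uniformly_continuous n e He) as [e' [He' H']].
    exists e'. split; [exact He'|]. intros t [Ht [s Hs]]. apply H. split; [lia|].
    exists (n + s)%nat. intros f g Hfg. rewrite !Nat.iter_add. apply H', Hs, Hfg. }
  assert (Hf := proj1 Hp).
  intros delta Hdelta.
  assert (HA : p (A (delta / 2))) by (apply Hi; exists (delta / 2); split; [lra|auto]).
  assert (Hret : forall f, p (fun t => d (Nat.iter t T f) f < delta / 2)).
  { intros f. destruct (ultrafilter_limit p (fun t => Nat.iter t T f) Hp) as [L HL].
    assert (E : f = L).
    { apply (idempotent_limit p); auto. apply (filter_up p Hf _ _ HA). intros n [Hn _]; exact Hn. }
    rewrite <- E in HL. apply HL. lra. }
  destruct (filter_ex p _ Hf (filter_and p Hf _ _ HA (filter_forall_in p l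
    (fun fg t => d (Nat.iter t T (fst fg)) (fst fg) < delta / 2) Hf (fun fg _ => Hret (fst fg)))))
    as [t [[_ [s Hs]] Ht]].
  exists s. intros f g Hfg. specialize (Hs f g Hfg). specialize (Ht _ Hfg). simpl in Ht.
  pose proof (dist_triangle (Nat.iter s T g) (Nat.iter t T f) f).
  rewrite (dist_sym (Nat.iter s T g) (Nat.iter t T f)) in *. lra.
Qed.

(** By minimality, the orbit of the tuple of all T^K f comes back near the tuple of all f. *)
Lemma joint_recurrence (l : list X) delta K :
  0 < delta -> exists t, (K <= t)%nat /\ forall f, In f l -> d (Nat.iter t T f) f < delta.
Proof.
  intros Hd.
  destruct (orbit_closure_symmetric (map (fun f => (f, Nat.iter K T f)) l)) with (delta := delta)
    as [s Hs]; [|exact Hd|].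
  - intros e He. exists K. intros f g Hfg. apply in_map_iff in Hfg.
    destruct Hfg as [h [E _]]. inversion E; subst. rewrite dist_refl. exact He.
  - exists (s + K)%nat. split; [lia|]. intros f Hf. rewrite Nat.iter_add. apply Hs.
    apply in_map_iff. exists f. auto.
Qed.

(** The times t approach the identity pointwise while T^t moves [xk k] near x'. Below, [xk]
    converges to a point x different from x', so this expresses a failure of equicontinuity at the
    identity. *)
Definition reachable (u : family) (xk : nat -> X) (x' : X) : Prop :=
  forall (F : list X) delta, 0 < delta ->
    u (fun k => exists t, d (Nat.iter t T (xk k)) x' < delta /\
      forall f, In f F -> d (Nat.iter t T f) f < delta).

Lemma first_crossing (P : nat -> Prop) n : P 0%nat -> ~ P n -> exists t, P t /\ ~ P (S t).
Proof.
  intros H0 Hn. apply NNPP. intros H. apply Hn. clear Hn. induction n as [|n IH]; [exact H0|].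
  apply NNPP. intros HS. apply H. exists n; auto.
Qed.

(* In terms of the Ellis group: if p is the limit of the T^(t k) along u and z is the limit
   of the T^(t k) (xk k), then x' is the point p^-1 z. *)
Lemma reachable_close u (xk : nat -> X) x eps eta :
  ultrafilter u -> (forall r, 0 < r -> u (fun k => d (xk k) x < r)) ->
  (forall k, exists n, eps <= d (Nat.iter n T x) (Nat.iter n T (xk k))) ->
  0 < eta <= eps ->
  exists x', x <> x' /\ reachable u xk x' /\
    exists n, d (Nat.iter n T x) (Nat.iter n T x') < 2 * eta.
Proof.
  intros Hu Hx Hfar [Heta Hle]. assert (Hf := proj1 Hu).
  (* The distance starts below [eta] and reaches [eps], which is at least [eta], so it crosses [eta]
     at some step. This concerns [u]-almost all k; the others get the time 0. *)
  destruct (choice (fun k t => d (xk k) x < eta ->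
    d (Nat.iter t T x) (Nat.iter t T (xk k)) < eta /\
    eta <= d (Nat.iter (S t) T x) (Nat.iter (S t) T (xk k)))) as [t Ht].
  { intros k. destruct (Rlt_dec (d (xk k) x) eta) as [Hk|Hk]; [|exists 0%nat; tauto].
    destruct (Hfar k) as [n Hn].
    destruct (first_crossing (fun t => d (Nat.iter t T x) (Nat.iter t T (xk k)) < eta) n)
      as [t [H1 H2]].
    - simpl. rewrite dist_sym. exact Hk.
    - lra.
    - exists t. intros _. split; [exact H1|lra]. }
  destruct (choice (fun f g => forall e, 0 < e -> u (fun k => d (Nat.iter (t k) T f) g < e)))
    as [g Hg].
  { intros f. apply (ultrafilter_limit u (fun k => Nat.iter (t k) T f) Hu). }
  destruct (ultrafilter_limit u (fun k => Nat.iter (t k) T (xk k)) Hu) as [z Hz].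
  assert (Hyz : d (g x) z <= eta).
  { apply Rnot_lt_le. intros Hlt. pose (e := (d (g x) z - eta) / 2).
    destruct (filter_ex u _ Hf (filter_and u Hf _ _ (Hx eta Heta)
      (filter_and u Hf _ _ (Hg x e ltac:(unfold e; lra)) (Hz e ltac:(unfold e; lra)))))
      as [k [Hk [H1 H2]]].
    apply Ht in Hk. destruct Hk as [Hk _].
    pose proof (dist_triangle (g x) (Nat.iter (t k) T x) z).
    pose proof (dist_triangle (Nat.iter (t k) T x) (Nat.iter (t k) T (xk k)) z).
    rewrite (dist_sym (g x) (Nat.iter (t k) T x)) in *. unfold e in *. lra. }
  (* If the limits agreed, so would their images under T, and one step later the distance would be
     below [eta] for many k. *)
  assert (Hne : g x <> z).
  { intros E.
    destruct (filter_ex u _ Hf (filter_and u Hf _ _ (Hx eta Heta)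
      (filter_and u Hf _ _
        (iter_limit u (fun k => Nat.iter (t k) T x) _ 1 Hf (Hg x) (eta / 2) ltac:(lra))
        (iter_limit u (fun k => Nat.iter (t k) T (xk k)) _ 1 Hf Hz (eta / 2) ltac:(lra)))))
      as [k [Hk [H1 H2]]].
    apply Ht in Hk. destruct Hk as [_ Hk]. simpl in *. rewrite E in H1.
    pose proof (dist_triangle (T (Nat.iter (t k) T x)) (T z) (T (Nat.iter (t k) T (xk k)))).
    rewrite (dist_sym (T z) (T (Nat.iter (t k) T (xk k)))) in *. lra. }
  (* Here g f is p f, and T^s approximates p^-1 on the points g f with f in [l]; x' is a cluster
     point of such T^s z. *)
  destruct (cluster_point (fun l r c => exists s, c = Nat.iter s T z /\
    forall f, In f l -> d (Nat.iter s T (g f)) f < r)) as [x' Hx'].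
  { intros l l' r r' c Hl Hr [s [E H]]. exists s. split; [exact E|].
    intros f Hin. specialize (H f (Hl f Hin)). lra. }
  { intros l r Hr.
    destruct (orbit_closure_symmetric (map (fun f => (f, g f)) l)) with (delta := r)
      as [s Hs]; [|exact Hr|].
    - intros e He.
      destruct (filter_ex u _ Hf (filter_forall_in u l
        (fun f k => d (Nat.iter (t k) T f) (g f) < e) Hf (fun f _ => Hg f e He))) as [k Hk].
      exists (t k). intros f h Hin. apply in_map_iff in Hin.
      destruct Hin as [f' [E Hin]]. inversion E; subst. apply Hk, Hin.
    - exists (Nat.iter s T z). exists s. split; [reflexivity|]. intros f Hin.
      apply Hs, in_map_iff. exists f. auto. }
  (* This says p x = g x and p x' = z along common times, again by symmetry of orbit closures. It
     carries both g x <> z and the bound [eta] back to the pair x, x'. *)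
  assert (Hback : forall r, 0 < r -> exists s, d (Nat.iter s T x) (g x) < r /\ d (Nat.iter s T x') z < r).
  { intros r Hr.
    destruct (orbit_closure_symmetric ((g x, x) :: (z, x') :: nil)) with (delta := r)
      as [s Hs]; [|exact Hr|].
    - intros e He. destruct (Hx' (x :: nil) e He) as [c [[s [-> Hs]] Hc]].
      exists s. intros f h [E|[E|[]]]; inversion E; subst; [|exact Hc].
      apply Hs. left; reflexivity.
    - exists s. split; apply Hs; simpl; auto. }
  exists x'. split; [|split].
  - intros <-. apply Hne, dist_eq. intros e He.
    destruct (Hback (e / 2)) as [s [H1 H2]]; [lra|].
    pose proof (dist_triangle (g x) (Nat.iter s T x) z).
    rewrite (dist_sym (g x) (Nat.iter s T x)) in *. lra.
  - intros F delta Hdelta.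
    destruct (Hx' F (delta / 2)) as [c [[s [-> Hs]] Hc]]; [lra|].
    apply (filter_up u Hf _ _ (filter_and u Hf _ _
      (iter_limit u (fun k => Nat.iter (t k) T (xk k)) _ s Hf Hz (delta / 2) ltac:(lra))
      (filter_forall_in u F (fun f k =>
        d (Nat.iter s T (Nat.iter (t k) T f)) (Nat.iter s T (g f)) < delta / 2) Hf
        (fun f _ => iter_limit u (fun k => Nat.iter (t k) T f) _ s Hf (Hg f) (delta / 2) ltac:(lra))))).
    (* T^(t k) approximates p and T^s approximates p^-1, so the composite nearly fixes [F] and sends
       [xk k] near p^-1 z = x'. *)
    intros k [H1 H2]. exists (s + t k)%nat. rewrite Nat.iter_add. split.
    + pose proof (dist_triangle (Nat.iter s T (Nat.iter (t k) T (xk k))) (Nat.iter s T z) x'). lra.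
    + intros f Hin. rewrite Nat.iter_add. specialize (H2 f Hin). specialize (Hs f Hin).
      pose proof (dist_triangle (Nat.iter s T (Nat.iter (t k) T f)) (Nat.iter s T (g f)) f). lra.
  - destruct (Hback (eta / 2)) as [s [H1 H2]]; [lra|]. exists s.
    pose proof (dist_triangle (Nat.iter s T x) (g x) (Nat.iter s T x')).
    pose proof (dist_triangle (g x) z (Nat.iter s T x')).
    rewrite (dist_sym z (Nat.iter s T x')) in *. lra.
Qed.

(** Proximality only looks at times n >= 1; the minimum with [d x y] takes care of time 0. *)
Lemma distal_separation x y :
  x <> y -> exists e, 0 < e /\ forall n, e <= d (Nat.iter n T x) (Nat.iter n T y).
Proof.
  intros Hne. apply NNPP. intros Hn. apply Hne, Hdist. intros eps Heps.
  apply NNPP. intros Hno. apply Hn. exists (Rmin eps (d x y)).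
  split; [apply Rmin_glb_lt; [exact Heps|apply dist_pos, Hne]|].
  intros [|n]; [apply Rmin_r|].
  apply Rnot_lt_le. intros Hlt. apply Hno. exists (S n). split; [lia|].
  pose proof (Rmin_l eps (d x y)). lra.
Qed.

(** One point y serves all of [xs], with a time depending on the target. Choosing the target at each
    position lets y follow any prescribed word over [xs]. *)
Definition jointly_reachable (xs : list X) : Prop :=
  forall (F : list X) delta, 0 < delta ->
    exists y, forall a, In a xs -> exists t, d (Nat.iter t T y) a < delta /\
      forall f, In f F -> d (Nat.iter t T f) f < delta.

Lemma exists_jointly_reachable (Hneq : ~ equicontinuous d T) n :
  exists xs, length xs = n /\ NoDup xs /\ jointly_reachable xs.
Proof.
  assert (Hx : exists x eps, 0 < eps /\ forall r, 0 < r ->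
    exists y, d x y < r /\ exists n, eps <= d (Nat.iter n T x) (Nat.iter n T y)).
  { apply NNPP. intros Hno. apply Hneq. intros x eps Heps. apply NNPP. intros Hd.
    apply Hno. exists x, eps. split; [exact Heps|]. intros r Hr. apply NNPP. intros Hy.
    apply Hd. exists r. split; [exact Hr|]. intros y m Hxy. apply Rnot_le_lt. intros Hle.
    apply Hy. exists y. split; [exact Hxy|]. exists m; exact Hle. }
  destruct Hx as [x [eps [Heps Hx]]].
  destruct (choice (fun k y => d x y < / INR (S k) /\
    exists n, eps <= d (Nat.iter n T x) (Nat.iter n T y))) as [xk Hxk].
  { intros k. apply Hx, Rinv_0_lt_compat, lt_0_INR. lia. }
  destruct (ultrafilter_extends (fun A => exists N, forall k, (N <= k)%nat -> A k)) as [u [Hcof Hu]].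
  { split.
    - exists 0%nat. auto.
    - intros A B [N H] HAB. exists N. auto.
    - intros A B [N H] [N' H']. exists (N + N')%nat. intros k Hk. split; [apply H|apply H']; lia.
    - intros [N H]. exact (H N (le_n N)). }
  assert (Hf := proj1 Hu).
  assert (Hlim : forall r, 0 < r -> u (fun k => d (xk k) x < r)).
  { intros r Hr. apply Hcof. destruct (archimed_cor1 r Hr) as [N [HN HN0]]. exists N.
    intros k Hk. rewrite dist_sym. apply Rlt_trans with (/ INR (S k)); [apply Hxk|].
    apply Rle_lt_trans with (/ INR N); [|exact HN].
    apply Rinv_le_contravar; [apply lt_0_INR; lia|apply le_INR; lia]. }
  (* [xk] and [u] stay the same throughout the induction, since in the end a single [xk k] must
     reach all the points. *)
  assert (Hmain : exists xs e, length xs = n /\ NoDup xs /\ 0 < e /\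
    forall a, In a xs -> reachable u xk a /\ forall m, e <= d (Nat.iter m T x) (Nat.iter m T a)).
  { clear Hneq. induction n as [|n IH].
    - exists nil, 1. repeat split; [constructor|lra|destruct H|destruct H].
    - destruct IH as [xs [e [Hlen [Hnd [He Hxs]]]]].
      (* With eta = min(eps, e/2) the new point comes closer to x than e at some time, whereas the
         orbits of the earlier points always stay at least e away from that of x; so it is new. *)
      pose proof (Rmin_l eps (e / 2)). pose proof (Rmin_r eps (e / 2)).
      destruct (reachable_close u xk x eps (Rmin eps (e / 2)) Hu Hlim (fun k => proj2 (Hxk k)))
        as [x' [Hne [Hreach [m Hm]]]].
      { split; [apply Rmin_glb_lt; lra|lra]. }
      destruct (distal_separation x x' Hne) as [e' [He' Hsep]].
      exists (x' :: xs), (Rmin e e'). split; [simpl; congruence|]. split.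
      + constructor; [|exact Hnd]. intros Hin. destruct (Hxs x' Hin) as [_ Hd].
        specialize (Hd m). lra.
      + split; [apply Rmin_glb_lt; assumption|].
        pose proof (Rmin_l e e'). pose proof (Rmin_r e e').
        intros a [<-|Hin].
        * split; [exact Hreach|]. intros m'. specialize (Hsep m'). lra.
        * destruct (Hxs a Hin) as [H3 H4]. split; [exact H3|]. intros m'. specialize (H4 m'). lra. }
  destruct Hmain as [xs [e [Hlen [Hnd [He Hxs]]]]]. exists xs. split; [exact Hlen|].
  split; [exact Hnd|]. intros F delta Hdelta.
  destruct (filter_ex u _ Hf (filter_forall_in u xs (fun a k => exists t,
    d (Nat.iter t T (xk k)) a < delta /\
    forall f, In f F -> d (Nat.iter t T f) f < delta) Hf
    (fun a Ha => proj1 (Hxs a Ha) F delta Hdelta))) as [k Hk].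
  exists (xk k). exact Hk.
Qed.

(** * Independence and sequence entropy *)

(* A word w is added by replacing t i with t i + s (w i), where T^(s a) sends the new point
   near a and nearly fixes the points obtained so far. *)
Lemma independent_times_aux xs x0 m (Hxs : jointly_reachable xs) (L : list (list X)) :
  (forall w, In w L -> forall i, (i < m)%nat -> In (nth i w x0) xs) ->
  forall delta, 0 < delta -> exists (t : nat -> nat) (Y : list X),
    (forall i a, (i < m)%nat -> In a xs -> d (Nat.iter (t i) T a) a < delta) /\
    forall w, In w L -> exists y, In y Y /\
      forall i, (i < m)%nat -> d (Nat.iter (t i) T y) (nth i w x0) < delta.
Proof.
  induction L as [|w L IH]; intros HL delta Hdelta.
  - exists (fun _ => 0%nat), nil. split; [|intros w []].
    intros i a _ _. simpl. rewrite dist_refl. exact Hdelta.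
  - destruct (IH (fun v Hv => HL v (or_intror Hv)) (delta / 2)) as [t [Y [Ha HY]]]; [lra|].
    destruct (finite_radius (seq 0 m) (fun i r => forall p q,
      d p q < r -> d (Nat.iter (t i) T p) (Nat.iter (t i) T q) < delta / 2)) as [r [Hr Hunif]].
    { intros i r r' H Hle p q Hpq. apply H. lra. }
    { intros i _. apply iter_uniformly_continuous. lra. }
    (* The new times nearly fix every T^(t i) f with f in [Y] or [xs], which preserves the earlier
       itineraries. Closeness below r survives the application of any T^(t i). *)
    destruct (Hxs (flat_map (fun i => map (Nat.iter (t i) T) (Y ++ xs)) (seq 0 m))
      (Rmin r (delta / 2))) as [y Hy]; [apply Rmin_glb_lt; lra|].
    pose proof (Rmin_l r (delta / 2)). pose proof (Rmin_r r (delta / 2)).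
    destruct (choice (fun a s => In a xs -> d (Nat.iter s T y) a < Rmin r (delta / 2) /\
      forall f, In f (flat_map (fun i => map (Nat.iter (t i) T) (Y ++ xs)) (seq 0 m)) ->
        d (Nat.iter s T f) f < Rmin r (delta / 2))) as [s Hs].
    { intros a. destruct (classic (In a xs)) as [Hin|Hin]; [|exists 0%nat; tauto].
      destruct (Hy a Hin) as [s Hs]. exists s. auto. }
    clear Hy.
    assert (Hret : forall i f, (i < m)%nat -> In f (Y ++ xs) ->
      d (Nat.iter (s (nth i w x0)) T (Nat.iter (t i) T f)) (Nat.iter (t i) T f) < delta / 2).
    { intros i f Hi Hf. destruct (Hs _ (HL w (or_introl eq_refl) i Hi)) as [_ H'].
      apply Rlt_le_trans with (Rmin r (delta / 2)); [|lra]. apply H'. apply in_flat_map. exists i.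
      split; [apply in_seq; lia|apply in_map, Hf]. }
    (* On earlier points T^(t i) acts first and its result is nearly fixed. On y the map T^s acts
       first and brings it near the letter, which T^(t i) nearly fixes by induction. *)
    exists (fun i => (s (nth i w x0) + t i)%nat), (y :: Y). split.
    + intros i a Hi Hin. rewrite Nat.iter_add. specialize (Ha i a Hi Hin).
      pose proof (Hret i a Hi (in_or_app _ _ _ (or_intror Hin))).
      pose proof (dist_triangle (Nat.iter (s (nth i w x0)) T (Nat.iter (t i) T a))
        (Nat.iter (t i) T a) a). lra.
    + intros v [<-|Hv].
      * exists y. split; [left; reflexivity|]. intros i Hi.
        assert (Hin := HL w (or_introl eq_refl) i Hi).
        rewrite Nat.add_comm, Nat.iter_add. destruct (Hs _ Hin) as [H' _].
        assert (H1 := Hunif i ltac:(apply in_seq; lia) (Nat.iter (s (nth i w x0)) T y) (nth i w x0)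
          ltac:(lra)).
        specialize (Ha i _ Hi Hin).
        pose proof (dist_triangle (Nat.iter (t i) T (Nat.iter (s (nth i w x0)) T y))
          (Nat.iter (t i) T (nth i w x0)) (nth i w x0)). lra.
      * destruct (HY v Hv) as [y' [Hy' Hd]]. exists y'. split; [right; exact Hy'|].
        intros i Hi. rewrite Nat.iter_add. specialize (Hd i Hi).
        pose proof (Hret i y' Hi (in_or_app _ _ _ (or_introl Hy'))).
        pose proof (dist_triangle (Nat.iter (s (nth i w x0)) T (Nat.iter (t i) T y'))
          (Nat.iter (t i) T y') (nth i v x0)). lra.
Qed.

(** To make the times increase and start beyond [K], large joint return times of the finitely many
    points T^(t i) y with y in [Y] are added; each changes the itineraries by less than delta /
    2. *)
Lemma independent_times xs x0 m delta K : jointly_reachable xs -> 0 < delta ->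
  exists t, strictly_increasing t /\ (K <= t 0)%nat /\
    forall w, In w (words xs m) -> exists y,
      forall i, (i < m)%nat -> d (Nat.iter (t i) T y) (nth i w x0) < delta.
Proof.
  intros Hxs Hdelta.
  destruct (independent_times_aux xs x0 m Hxs (words xs m)) with (delta := delta / 2)
    as [t [Y [_ HY]]].
  { intros w Hw. apply (in_words x0) in Hw. apply Hw. }
  { lra. }
  destruct (choice (fun k s => (k <= s)%nat /\
    forall f, In f (flat_map (fun i => map (Nat.iter (t i) T) Y) (seq 0 m)) ->
      d (Nat.iter s T f) f < delta / 2)) as [r Hr].
  { intros k. apply joint_recurrence. lra. }
  pose (s := fix s i := (t i + r (match i with O => K | S j => S (s j) end))%nat).
  assert (Hs : forall i, exists k, s i = (r k + t i)%nat).
  { intros [|i]; simpl; eexists; apply Nat.add_comm. }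
  exists s. split; [|split].
  - apply strictly_increasing_succ. intros i. simpl. destruct (Hr (S (s i))) as [H _]. lia.
  - simpl. destruct (Hr K) as [H _]. lia.
  - intros w Hw. destruct (HY w Hw) as [y [Hy Hd]]. exists y. intros i Hi.
    destruct (Hs i) as [k ->]. rewrite Nat.iter_add. specialize (Hd i Hi).
    destruct (Hr k) as [_ H]. specialize (H (Nat.iter (t i) T y)).
    assert (d (Nat.iter (r k) T (Nat.iter (t i) T y)) (Nat.iter (t i) T y) < delta / 2).
    { apply H, in_flat_map. exists i. split; [apply in_seq; lia|apply in_map, Hy]. }
    pose proof (dist_triangle (Nat.iter (r k) T (Nat.iter (t i) T y))
      (Nat.iter (t i) T y) (nth i w x0)). lra.
Qed.

(* [t] lists the blocks j = 0, 1, ... in order; block j consists of 2^j times and occupies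
   the positions 2^j - 1, ..., 2^(j+1) - 2, that is, more than half of the prefix it ends. *)
Lemma independent_blocks xs x0 delta : jointly_reachable xs -> 0 < delta ->
  exists t, strictly_increasing t /\
    forall j w, In w (words xs (2 ^ j)) -> exists y, forall i, (i < 2 ^ j)%nat ->
      d (Nat.iter (t (2 ^ j - 1 + i)%nat) T y) (nth i w x0) < delta.
Proof.
  intros Hxs Hdelta.
  destruct (choice (fun (mK : nat * nat) t => strictly_increasing t /\ (snd mK <= t 0)%nat /\
    forall w, In w (words xs (fst mK)) -> exists y,
      forall i, (i < fst mK)%nat -> d (Nat.iter (t i) T y) (nth i w x0) < delta)) as [B HB].
  { intros [m K]. apply independent_times; assumption. }
  (* [K (S j)] exceeds the last time of block j, whose index there is 2^j - 1. *)
  pose (K := fix K j := match j with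
    | O => 0%nat | S j => S (B (2 ^ j, K j)%nat (2 ^ j - 1)%nat) end).
  (* Position q lies in block j = log2 (q + 1), at offset q + 1 - 2^j. *)
  pose (t := fun q => let j := Nat.log2 (S q) in B (2 ^ j, K j)%nat (S q - 2 ^ j)%nat).
  assert (Ht : forall j i, (i < 2 ^ j)%nat -> t (2 ^ j - 1 + i)%nat = B (2 ^ j, K j)%nat i).
  { intros j i Hi. unfold t.
    assert (E : Nat.log2 (S (2 ^ j - 1 + i)) = j).
    { apply Nat.log2_unique; [lia|]. simpl. lia. }
    rewrite E. cbv zeta. f_equal. lia. }
  exists t. split.
  - apply strictly_increasing_succ. intros q.
    destruct (Nat.log2_spec (S q)) as [Hlo Hhi]; [lia|].
    set (j := Nat.log2 (S q)) in *.
    assert (Hj : (2 ^ j <> 0)%nat) by (apply Nat.pow_nonzero; lia).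
    assert (Eq : q = (2 ^ j - 1 + (S q - 2 ^ j))%nat) by lia.
    destruct (Nat.eq_dec (S (S q)) (2 ^ S j)) as [E|E].
    + assert (Eq' : S q = (2 ^ S j - 1 + 0)%nat) by lia.
      rewrite Eq', (Ht (S j) 0%nat) by lia. rewrite Eq, Ht by (simpl in *; lia).
      replace (S q - 2 ^ j)%nat with (2 ^ j - 1)%nat by (simpl in E; lia).
      destruct (HB (2 ^ S j, K (S j))%nat) as [_ [H _]].
      change (snd (2 ^ S j, K (S j))%nat) with (S (B (2 ^ j, K j)%nat (2 ^ j - 1)%nat)) in H. lia.
    + assert (Eq' : S q = (2 ^ j - 1 + S (S q - 2 ^ j))%nat) by lia.
      rewrite Eq', (Ht j (S (S q - 2 ^ j))%nat) by (simpl in *; lia).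
      rewrite Eq at 1. rewrite Ht by (simpl in *; lia).
      destruct (HB (2 ^ j, K j)%nat) as [H _]. apply H. lia.
  - intros j w Hw. destruct (HB (2 ^ j, K j)%nat) as [_ [_ H]].
    destruct (H w Hw) as [y Hy]. exists y. intros i Hi. rewrite Ht by exact Hi. apply Hy, Hi.
Qed.

(* Each element of the join sees at most [c] letters at each time of an independent block. *)
Lemma join_subcover_lower_bound xs x0 delta U (A : (X -> Prop) -> list X) c t q m P N :
  NoDup xs ->
  (forall V, In V U -> (length (A V) <= c)%nat /\
     forall a y, In a xs -> V y -> d y a < delta -> In a (A V)) ->
  (forall w, In w (words xs m) -> exists y, forall i, (i < m)%nat ->
     d (Nat.iter (t (q + i)%nat) T y) (nth i w x0) < delta) ->
  (q + m <= P)%nat -> join_subcover_card T U t P N ->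
  (length xs ^ m <= N * c ^ m)%nat.
Proof.
  intros Hnd HA Hind HP [fs [Hlen [Hval Hcov]]]. rewrite Forall_forall in Hval.
  assert (HAf : forall f i, In f fs -> (i < m)%nat -> In (nth (f (q + i)%nat) U (fun _ => False)) U).
  { intros f i Hf Hi. apply nth_In, (Hval f Hf). lia. }
  (* [G f] lists the words that points of the join element [f] can follow, at most c^m of them.
     Every word over [xs] occurs in some [G f]. *)
  pose (G := fun f : nat -> nat => list_choices (map (fun i => A (nth (f (q + i)%nat) U (fun _ => False))) (seq 0 m))).
  rewrite <- words_length. apply Nat.le_trans with (length (flat_map G fs)).
  - apply NoDup_incl_length; [apply words_NoDup, Hnd|]. intros w Hw.
    destruct (Hind w Hw) as [y Hy]. destruct (Hcov y) as [f [Hf Hj]].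
    apply in_flat_map. exists f. split; [exact Hf|].
    apply (in_words x0) in Hw. destruct Hw as [Hlw Hw].
    apply (in_list_choices x0). rewrite length_map, length_seq. split; [exact Hlw|].
    intros i Hi. rewrite nth_indep with (d' := A (nth (f (q + 0)%nat) U (fun _ => False)))
      by (rewrite length_map, length_seq; exact Hi).
    rewrite (map_nth (fun i => A (nth (f (q + i)%nat) U (fun _ => False))) (seq 0 m) 0%nat i), seq_nth by exact Hi.
    apply (proj2 (HA _ (HAf f i Hf Hi)) _ (Nat.iter (t (q + i)%nat) T y)); auto.
    apply Hj. lia.
  - rewrite <- Hlen. apply length_flat_map_le. intros f Hf. unfold G.
    eapply Nat.le_trans; [apply list_choices_length_le with (c := c)|].
    + intros l Hl. apply in_map_iff in Hl. destruct Hl as [i [<- Hi]]. apply in_seq in Hi.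
      apply HA, HAf; [exact Hf|lia].
    + rewrite length_map, length_seq. lia.
Qed.

(** [A V] contains the points of [xs] that V meets up to delta. The prefix of length P = 2^(N+1) - 1
    ends with a block of 2^N times, whence |xs|^(2^N) <= M c^(2^N) for the subcover number M; P <= 2
    * 2^N accounts for the factor 1/2. *)
Lemma sequence_entropy_lower_bound xs (x0 : X) delta U (A : (X -> Prop) -> list X) c :
  jointly_reachable xs -> NoDup xs -> 0 < delta -> (1 <= c <= length xs)%nat ->
  (forall x, exists V, In V U /\ V x) ->
  (forall V, In V U -> (length (A V) <= c)%nat /\
     forall a y, In a xs -> V y -> d y a < delta -> In a (A V)) ->
  exists t l, strictly_increasing t /\ htopA_cover T U t l /\
    (ln (INR (length xs)) - ln (INR c)) / 2 <= l.
Proof.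
  intros Hxs Hnd Hdelta Hc Hcov HA.
  destruct (independent_blocks xs x0 delta Hxs Hdelta) as [t [Hinc Hind]].
  destruct (limsup_exists (hseq T U t) (ln (INR (length U)))
    ((ln (INR (length xs)) - ln (INR c)) / 2)) as [l [Hl Hle]].
  - intros n Hn. apply hseq_le; assumption.
  - intros N. exists (2 ^ N - 1 + 2 ^ N)%nat.
    assert (Hgt := Nat.pow_gt_lin_r 2 N ltac:(lia)). split; [lia|].
    set (P := (2 ^ N - 1 + 2 ^ N)%nat).
    destruct (Njoin_spec T U t P Hcov) as [Hcard _].
    pose proof (Njoin_pos T U t P x0 Hcov) as Hpos.
    assert (Hcount := join_subcover_lower_bound xs x0 delta U A c t (2 ^ N - 1) (2 ^ N) P _
      Hnd HA (Hind N) (le_n _) Hcard).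
    unfold hseq. set (M := Njoin T U t P) in *.
    assert (HM : 0 < INR M) by (apply lt_0_INR; lia).
    assert (Hcr : 0 < INR c) by (apply lt_0_INR; lia).
    assert (Hxr : 0 < INR (length xs)) by (apply lt_0_INR; lia).
    apply le_INR in Hcount. rewrite mult_INR, !pow_INR in Hcount.
    assert (Hln : INR (2 ^ N) * ln (INR (length xs)) <= ln (INR M) + INR (2 ^ N) * ln (INR c)).
    { rewrite <- !ln_pow by assumption. rewrite <- ln_mult by (try apply pow_lt; assumption).
      destruct Hcount as [Hlt|E]; [left; apply ln_increasing; [apply pow_lt; assumption|exact Hlt]|].
      right. rewrite E. reflexivity. }
    assert (HD : 0 <= ln (INR (length xs)) - ln (INR c)).
    { assert (INR c <= INR (length xs)) as [Hlt|E] by (apply le_INR; lia).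
      - pose proof (ln_increasing _ _ Hcr Hlt). lra.
      - rewrite E. lra. }
    assert (HP : 0 < INR P <= 2 * INR (2 ^ N)).
    { split; [apply lt_0_INR; unfold P; lia|].
      replace 2 with (INR 2) by reflexivity. rewrite <- mult_INR. apply le_INR. unfold P. lia. }
    apply Rmult_le_reg_r with (INR P); [lra|].
    unfold Rdiv at 2. rewrite Rmult_assoc, Rinv_l, Rmult_1_r by lra. nra.
  - exists t, l. auto.
Qed.

End CompactMetric.

(** * Sequence entropy tuples and unbounded sequence entropy *)

Theorem mainTheorem6 (X : Type) (d : X -> X -> R) (T : X -> X)
  (Hmet : is_metric d) (Hcpt : compact_metric d) (Hcont : continuous_map d T)
  (Hdist : distal d T) (Hneq : ~ equicontinuous d T) :
  (forall n : nat, (2 <= n)%nat -> exists xs : list X, in_SEe d T n xs) /\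
  (* sup_A h^A_top(T) = sup_A sup_U h^A_top(T,U) = +oo *)
  (forall M : R, exists (t : nat -> nat) (U : list (X -> Prop)) (l : R),
     strictly_increasing t /\ finite_open_cover d U /\ htopA_cover T U t l /\ M < l).
Proof.
  split.
  - intros n Hn.
    destruct (exists_jointly_reachable d Hmet Hcpt T Hcont Hdist Hneq n) as [xs [Hlen [Hnd Hxs]]].
    exists xs. split; [exact Hlen|]. split; [exact Hnd|].
    destruct xs as [|x0 [|x1 xs']] eqn:Exs; simpl in Hlen; [lia|lia|]. rewrite <- Exs in *.
    split.
    + exists x0, x1. rewrite Exs in *. split; [left; reflexivity|]. split; [right; left; reflexivity|].
      intros E. inversion Hnd as [|? ? H _]. apply H. left. symmetry; exact E.
    + intros U [HUo HUc] Hadm.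
      destruct (choice (fun V a => In V U -> In a xs /\ ~ closure d V a)) as [b Hb].
      { intros V. destruct (classic (In V U)) as [HV|HV]; [|exists x0; tauto].
        destruct (Hadm V HV) as [a Ha]. exists a. auto. }
      destruct (finite_radius U (fun V r => forall y, V y -> d y (b V) < r -> False))
        as [delta [Hdelta Hsep]].
      { intros V r r' H Hle y HV Hy. apply (H y HV). lra. }
      { intros V HV. apply NNPP. intros Hno. apply (proj2 (Hb V HV)). intros r Hr.
        apply NNPP. intros Hy. apply Hno. exists r. split; [exact Hr|].
        intros y HVy Hd. apply Hy. exists y. rewrite (dist_sym d Hmet). auto. }
      (* V misses the ball of radius delta around b V, so only the other points of [xs] remain and c
         = length xs - 1. *)
      destruct (choice (fun V A => In V U -> (length A <= length xs - 1)%nat /\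
        forall a, In a xs -> a <> b V -> In a A)) as [A HA].
      { intros V. destruct (classic (In V U)) as [HV|HV]; [|exists nil; tauto].
        destruct (Hb V HV) as [Hin _]. apply in_split in Hin. destruct Hin as [l1 [l2 E]].
        exists (l1 ++ l2). intros _. rewrite E. split; [rewrite !length_app; simpl; lia|].
        intros a Ha Hne. apply in_app_iff in Ha. apply in_app_iff.
        destruct Ha as [Ha|[Ha|Ha]]; [auto|congruence|auto]. }
      destruct (sequence_entropy_lower_bound d Hmet Hcpt T Hcont Hdist xs x0 delta U A
        (length xs - 1)) as [t [l [Ht [Hl Hle]]]]; auto.
      * rewrite Exs. simpl. lia.
      * intros V HV. split; [apply HA, HV|]. intros a y Ha HVy Hd.
        apply HA; [exact HV|exact Ha|]. intros ->. exact (Hsep V HV y HVy Hd).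
      * exists t. split; [exact Ht|]. exists l. split; [exact Hl|].
        assert (ln (INR (length xs - 1)) < ln (INR (length xs))).
        { apply ln_increasing; [apply lt_0_INR|apply lt_INR]; rewrite Exs; simpl; lia. }
        lra.
  - intros M.
    (* The cover below has c = 1 and yields entropy at least half the logarithm of the number of
       points, so more than exp(2M) points suffice. *)
    destruct (INR_unbounded (exp (2 * M))) as [n Hn].
    destruct (exists_jointly_reachable d Hmet Hcpt T Hcont Hdist Hneq (S n)) as [xs [Hlen [Hnd Hxs]]].
    assert (Hx0 : exists x0, In x0 xs).
    { destruct xs as [|x0 xs']; [discriminate|]. exists x0. left; reflexivity. }
    destruct Hx0 as [x0 Hx0].
    destruct (finite_radius xs (fun a r => forall b, In b xs -> a <> b -> 2 * r < d a b))
      as [r [Hr Hsep]].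
    { intros a r r' H Hle b Hb Hne. specialize (H b Hb Hne). lra. }
    { intros a _. apply finite_radius with (Q := fun b r => a <> b -> 2 * r < d a b).
      - intros b r r' H Hle Hne. specialize (H Hne). lra.
      - intros b _. destruct (classic (a = b)) as [E|E]; [exists 1; split; [lra|tauto]|].
        pose proof (dist_pos d Hmet a b E). exists (d a b / 3). split; [lra|]. intros _. lra. }
    (* V a removes the closed r-balls around the other points of [xs]. These balls are disjoint, so
       the sets V a cover the space, and a point of V a is closer than r to no point of [xs] except
       possibly a. *)
    pose (V := fun a y => forall b, In b xs -> a <> b -> r < d b y).
    pose (U := map V xs).
    destruct (choice (fun W a => In W U -> W = V a)) as [b Hb].
    { intros W. destruct (classic (In W U)) as [HW|HW]; [|exists x0; tauto].
      apply in_map_iff in HW. destruct HW as [a [<- _]]. exists a. auto. }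
    assert (HUc : forall y, exists W, In W U /\ W y).
    { intros y. destruct (classic (exists a, In a xs /\ d a y <= r)) as [[a [Ha Hd]]|Hno].
      - exists (V a). split; [apply in_map, Ha|]. intros c Hc Hne.
        specialize (Hsep a Ha c Hc Hne). pose proof (dist_triangle d Hmet a y c).
        rewrite (dist_sym d Hmet c y). lra.
      - exists (V x0). split; [apply in_map, Hx0|]. intros c Hc _.
        apply Rnot_le_lt. intros Hle. apply Hno. exists c. auto. }
    destruct (sequence_entropy_lower_bound d Hmet Hcpt T Hcont Hdist xs x0 r U
      (fun W => b W :: nil) 1) as [t [l [Ht [Hl Hle]]]]; auto.
    + lia.
    + intros W HW. split; [simpl; lia|]. intros a y Ha HWy Hd. left.
      apply NNPP. intros Hne. rewrite (Hb W HW) in HWy. specialize (HWy a Ha Hne).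
      rewrite (dist_sym d Hmet) in HWy. lra.
    + exists t, U, l. split; [exact Ht|]. split; [split; [|exact HUc]|].
      * apply Forall_forall. intros W HW. apply in_map_iff in HW. destruct HW as [a [<- _]].
        intros y Hy.
        destruct (finite_radius xs (fun c s => a <> c -> s <= d c y - r)) as [s [Hs H]].
        { intros c s s' H Hle' Hne. specialize (H Hne). lra. }
        { intros c Hc. destruct (classic (a = c)) as [E|E]; [exists 1; split; [lra|tauto]|].
          specialize (Hy c Hc E). exists (d c y - r). split; lra. }
        exists s. split; [exact Hs|]. intros z Hz c Hc Hne. specialize (H c Hc Hne).
        pose proof (dist_triangle d Hmet c z y). rewrite (dist_sym d Hmet z y) in *. lra.
      * split; [exact Hl|]. rewrite Hlen in Hle. change (INR 1) with 1 in Hle. rewrite ln_1 in Hle.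
        assert (2 * M < ln (INR (S n))); [|lra].
        rewrite <- (ln_exp (2 * M)). apply ln_increasing; [apply exp_pos|].
        rewrite S_INR. lra.
Qed.
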